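(* There are, up to isomorphism, exactly three simple $\mathcal{A}_0$-modules, namely the extensions $S_\epsilon$, $S_{\operatorname{sgn}}$ and $S_{\operatorname{st}}$ of the simple $\Bbbk\mathbb{S}_3$-modules $W_\epsilon$, $W_{\operatorname{sgn}}$, $W_{\operatorname{st}}$, on which all $a_i$ act by zero.
   Context: $\Bbbk$ is an algebraically closed field of characteristic zero. $\mathcal{A}_0$ is the 72-dimensional Hopf algebra generated as an algebra by $H_t$ ($t\in\mathbb{S}_3$) and $a_{12},a_{13},a_{23}$ (indexed by the transpositions of $\mathbb{S}_3$), with relations $H_e=1$, $H_tH_s=H_{ts}$; $H_ta_i=\operatorname{sgn}(t)a_{tit^{-1}}H_t$; $a_{12}^2=0$; $a_{12}a_{23}+a_{23}a_{13}+a_{13}a_{12}=0$. $W_\epsilon$, $W_{\operatorname{sgn}}$, $W_{\operatorname{st}}$ are the trivial, sign and 2-dimensional standard representations of $\mathbb{S}_3$. *)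

(* Defs.v *)
From HB Require Import structures.
From mathcomp Require Import all_boot all_order all_fingroup all_algebra.
From mathcomp Require Import generic_quotient ring_quotient mxrepresentation.
From mathcomp Require Import finmap monalg.
From mathcomp Require boolp.

Set Implicit Arguments.
Unset Strict Implicit.
Unset Printing Implicit Defensive.

Import GRing.Theory.
Local Open Scope ring_scope.
Local Open Scope quotient_scope.

(* The points 1, 2, 3 permuted by S_3 are the ordinals 0, 1, 2 of 'I_3.       *)
(* MathComp composes permutations from left to right: (s * t)%g is s first,    *)
(* then t. Hence the product t s of S_3 is written (s * t)%g, and the         *)
(* conjugate t i t^-1 is (t^-1 * i * t)%g = (i ^ t)%g; when i swaps x and y,  *)
(* (i ^ t)%g swaps t x and t y. With these conventions, a MathComp            *)
(* representation rG of S_3, with t acting on row vectors by v |-> v *m rG t, *)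
(* is a left module: (t s) v = v *m rG (s * t)%g = (v *m rG s) *m rG t.       *)

Definition pt1 : 'I_3 := @Ordinal 3 0 isT.
Definition pt2 : 'I_3 := @Ordinal 3 1 isT.
Definition pt3 : 'I_3 := @Ordinal 3 2 isT.

Definition is_transposition (s : 'S_3) : bool :=
  [exists x, exists y, (x != y) && (s == tperm x y)].

Notation transposition := {s : 'S_3 | is_transposition s}.

Lemma is_transposition_tperm (x y : 'I_3) :
  x != y -> is_transposition (tperm x y).
Proof.
by move=> xy; apply/existsP; exists x; apply/existsP; exists y; rewrite xy /=.
Qed.

Lemma is_transpositionJ (s t : 'S_3) :
  is_transposition s -> is_transposition (s ^ t)%g.
Proof.
case/existsP=> x /existsP[y /andP[xy /eqP->]]; rewrite tpermJ.
by apply: is_transposition_tperm; rewrite (inj_eq perm_inj).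
Qed.

Definition swap (x y : 'I_3) (xy : x != y) : transposition :=
  exist _ (tperm x y) (is_transposition_tperm xy).

Definition conj_transp (i : transposition) (t : 'S_3) : transposition :=
  exist _ (val i ^ t)%g (is_transpositionJ t (valP i)).

Definition t12 : transposition := @swap pt1 pt2 isT.
Definition t13 : transposition := @swap pt1 pt3 isT.
Definition t23 : transposition := @swap pt2 pt3 isT.

(* Two-sided ideals and the quotient ring; the library builds the quotient by *)
(* an additive subgroup, and its ring structure only in the commutative case. *)
Section TwoSidedIdeal.
Variables (F : nzRingType) (r : F -> Prop).

Inductive ideal_gen : F -> Prop :=
| IdealGen x of r x : ideal_gen x
| Ideal0 : ideal_gen 0
| IdealB x y of ideal_gen x & ideal_gen y : ideal_gen (x - y)
| IdealMl u x of ideal_gen x : ideal_gen (u * x)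
| IdealMr x u of ideal_gen x : ideal_gen (x * u).

Definition ideal_pred : {pred F} := fun x => boolp.asbool (ideal_gen x).

Lemma ideal_predP x : reflect (ideal_gen x) (x \in ideal_pred).
Proof. exact: boolp.asboolP. Qed.

Lemma ideal_zmod_closed : zmod_closed ideal_pred.
Proof.
split=> [|x y /ideal_predP Ix /ideal_predP Iy]; apply/ideal_predP.
  exact: Ideal0.
exact: IdealB.
Qed.

HB.instance Definition _ :=
  GRing.isZmodClosed.Build F ideal_pred ideal_zmod_closed.

Definition ring_quot : Type := Quotient.quot ideal_pred.
HB.instance Definition _ := GRing.Zmodule.on ring_quot.
HB.instance Definition _ : EqQuotient F (Quotient.equiv ideal_pred) ring_quot :=
  EqQuotient.on ring_quot.

(* The locks only prevent costly unfoldings during unification.               *)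
Definition quot_pi (x : F) : ring_quot :=
  locked (fun y => \pi_ring_quot y) x.

Lemma quot_piP (x y : F) : quot_pi x = quot_pi y <-> ideal_gen (x - y).
Proof.
rewrite /quot_pi -lock.
have -> : (\pi_ring_quot x = \pi_ring_quot y) <-> (x - y \in ideal_pred).
  by rewrite (Quotient.idealrBE ideal_pred); split=> /eqP.
by split=> /ideal_predP.
Qed.

Lemma quot_reprK (x : ring_quot) : quot_pi (repr x) = x.
Proof. by rewrite /quot_pi -lock; apply: reprK. Qed.

Lemma quot_pi_surj (x : ring_quot) : exists y, x = quot_pi y.
Proof. by exists (repr x); rewrite quot_reprK. Qed.

Lemma quot_piD (x y : F) : quot_pi (x + y) = quot_pi x + quot_pi y.
Proof. by rewrite /quot_pi -lock; apply: (Quotient.pi_add ideal_pred). Qed.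

Definition quot_one : ring_quot := quot_pi 1.
Definition quot_mul (x y : ring_quot) : ring_quot :=
  locked (fun x' y' => quot_pi (repr x' * repr y')) x y.

Lemma quot_pi_mul (x y : F) : quot_mul (quot_pi x) (quot_pi y) = quot_pi (x * y).
Proof.
have Irepr z : ideal_gen (repr (quot_pi z) - z) by apply/quot_piP/quot_reprK.
rewrite /quot_mul -lock; apply/quot_piP.
have -> : repr (quot_pi x) * repr (quot_pi y) - x * y
  = repr (quot_pi x) * (repr (quot_pi y) - y)
    - (0 - (repr (quot_pi x) - x) * y).
  by rewrite sub0r opprK mulrBr mulrBl addrA subrK.
apply: IdealB; first exact/IdealMl/Irepr.
exact/(IdealB Ideal0)/IdealMr/Irepr.
Qed.

Lemma quot_mulA : associative quot_mul.
Proof.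
move=> x y z; have [x' ->] := quot_pi_surj x.
have [[y' ->] [z' ->]] := (quot_pi_surj y, quot_pi_surj z).
by rewrite !quot_pi_mul mulrA.
Qed.

Lemma quot_mul1 : left_id quot_one quot_mul.
Proof. by move=> x; have [x' ->] := quot_pi_surj x; rewrite quot_pi_mul mul1r. Qed.

Lemma quot_mulr1 : right_id quot_one quot_mul.
Proof. by move=> x; have [x' ->] := quot_pi_surj x; rewrite quot_pi_mul mulr1. Qed.

Lemma quot_mulDl : left_distributive quot_mul +%R.
Proof.
move=> x y z; have [x' ->] := quot_pi_surj x.
have [[y' ->] [z' ->]] := (quot_pi_surj y, quot_pi_surj z).
by rewrite -quot_piD !quot_pi_mul mulrDl quot_piD.
Qed.

Lemma quot_mulDr : right_distributive quot_mul +%R.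
Proof.
move=> x y z; have [x' ->] := quot_pi_surj x.
have [[y' ->] [z' ->]] := (quot_pi_surj y, quot_pi_surj z).
by rewrite -quot_piD !quot_pi_mul mulrDr quot_piD.
Qed.

HB.instance Definition _ := GRing.Zmodule_isPzRing.Build ring_quot
  quot_mulA quot_mul1 quot_mulr1 quot_mulDl quot_mulDr.

Lemma quot_piM (x y : F) : quot_pi (x * y) = quot_pi x * quot_pi y.
Proof. by rewrite -quot_pi_mul. Qed.

End TwoSidedIdeal.

Section QuotientAlgebra.
Variables (k : comNzRingType) (F : algType k) (r : F -> Prop).
Local Notation Q := (ring_quot r).

Definition quot_scale (c : k) (x : Q) : Q := quot_pi r c%:A * x.

Lemma quot_scaleA b c x : quot_scale b (quot_scale c x) = quot_scale (b * c) x.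
Proof.
by rewrite /quot_scale mulrA -quot_piM -scalerAl mul1r scalerA.
Qed.

Lemma quot_scale1 : left_id 1 quot_scale.
Proof. by move=> x; rewrite /quot_scale scale1r [LHS]mul1r. Qed.

Lemma quot_scaleDr : right_distributive quot_scale +%R.
Proof. by move=> c x y; rewrite /quot_scale mulrDr. Qed.

Lemma quot_scaleDl x : {morph quot_scale^~ x : b c / b + c}.
Proof. by move=> b c; rewrite /quot_scale scalerDl quot_piD mulrDl. Qed.

HB.instance Definition _ := GRing.Zmodule_isLmodule.Build k Q
  quot_scaleA quot_scale1 quot_scaleDr quot_scaleDl.

Lemma quot_piZ c (x : F) : quot_pi r (c *: x) = c *: quot_pi r x.
Proof.
rewrite [RHS](_ : _ = quot_pi r c%:A * quot_pi r x) //.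
by rewrite -quot_piM -scalerAl mul1r.
Qed.

Lemma quot_scalerAl (c : k) (x y : Q) : c *: (x * y) = (c *: x) * y.
Proof. exact: mulrA. Qed.

Lemma quot_scalerAr (c : k) (x y : Q) : c *: (x * y) = x * (c *: y).
Proof.
have [[x' ->] [y' ->]] := (quot_pi_surj x, quot_pi_surj y).
by rewrite -quot_piM -!quot_piZ -quot_piM scalerAr.
Qed.

Lemma quot_piB (x y : F) : quot_pi r (x - y) = quot_pi r x - quot_pi r y.
Proof. by rewrite quot_piD -scaleN1r quot_piZ scaleN1r. Qed.

Lemma quot_pi0 : quot_pi r 0 = 0.
Proof. by rewrite -(subrr 0) quot_piB subrr. Qed.

Lemma quot_pi_rel x : r x -> quot_pi r x = 0.
Proof.
move=> rx; rewrite -quot_pi0; apply/quot_piP.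
by rewrite subr0; apply: IdealGen.
Qed.

End QuotientAlgebra.

(* The free algebra on I: the monoid algebra of the free monoid on I.         *)
Section FreeAlgebra.
Variables (k : fieldType) (I : choiceType).

Definition free_alg : Type := {malg k[{fmonom I}]}.
HB.instance Definition _ := GRing.Lalgebra.on free_alg.

Lemma free_scalerAr (c : k) (x y : free_alg) : c *: (x * y) = x * (c *: y).
Proof.
have scaleU a w : c *: << a *g w >> = << c * a *g w >> :> {malg k[{fmonom I}]}.
  by apply/malgP=> w'; rewrite mcoeffZ !mcoeffU mulrnAr.
rewrite [RHS](malgMEw (fsubset_refl _) (msuppZ_le c y)) [x * y]malgME.
rewrite [LHS]scaler_sumr; apply: eq_bigr => v _.
rewrite [LHS]scaler_sumr; apply: eq_bigr => w _.
by rewrite [LHS]scaleU mcoeffZ mulrCA.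
Qed.

HB.instance Definition _ := GRing.Lalgebra_isAlgebra.Build k free_alg
  free_scalerAr.

Definition free_gen (i : I) : free_alg := locked (fun j => << fmu j >>) i.

(* The anti-morphism from the free algebra to matrices sending each generator *)
(* i to g i; matrices multiply row vectors on the right.                      *)
Section FreeMx.
Variables (n : nat) (g : I -> 'M[k]_n).

Definition word_mx (w : seq I) : 'M[k]_n :=
  foldr (fun i M => M *m g i) 1%:M w.

Lemma word_mx_cat u w : word_mx (u ++ w) = word_mx w *m word_mx u.
Proof.
by elim: u => [|i u IHu] /=; rewrite ?mulmx1 // IHu mulmxA.
Qed.

Definition free_mx (x : free_alg) : 'M[k]_n :=
  \sum_(w <- msupp x) x@_w *: word_mx w.

Lemma free_mxEw (D : {fset {fmonom I}}) (x : free_alg) :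
  fsubset (msupp x) D -> free_mx x = \sum_(w <- D) x@_w *: word_mx w.
Proof.
move=> le; rewrite [LHS](big_fset_incl _ le) => //= w _ /mcoeff_outdom ->.
by rewrite scale0r.
Qed.

Lemma free_mxU c w : free_mx << c *g w >> = c *: word_mx w.
Proof. by rewrite (free_mxEw msuppU_le) big_seq_fset1 mcoeffUU. Qed.

Lemma free_mxD (x y : free_alg) : free_mx (x + y) = free_mx x + free_mx y.
Proof.
rewrite (free_mxEw (msuppD_le x y)) (free_mxEw (fsubsetUl (msupp x) (msupp y))).
rewrite (free_mxEw (fsubsetUr (msupp x) (msupp y))) -big_split /=.
by apply: eq_bigr => w _; rewrite mcoeffD scalerDl.
Qed.

Lemma free_mxZ c (x : free_alg) : free_mx (c *: x) = c *: free_mx x.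
Proof.
rewrite (free_mxEw (msuppZ_le c x)) scaler_sumr.
by apply: eq_bigr => w _; rewrite mcoeffZ scalerA.
Qed.

Lemma free_mx0 : free_mx 0 = 0.
Proof. by rewrite -(scale0r (0 : free_alg)) free_mxZ scale0r. Qed.

Lemma free_mxB (x y : free_alg) : free_mx (x - y) = free_mx x - free_mx y.
Proof. by rewrite free_mxD -scaleN1r free_mxZ scaleN1r. Qed.

Lemma free_mx1 : free_mx 1 = 1%:M.
Proof. by rewrite [LHS]free_mxU scale1r fm1. Qed.

Lemma free_mxM (x y : free_alg) : free_mx (x * y) = free_mx y *m free_mx x.
Proof.
rewrite [x * y]malgME [LHS](big_morph _ free_mxD free_mx0) /= mulmx_sumr.
apply: eq_bigr => u _; rewrite [LHS](big_morph _ free_mxD free_mx0) mulmx_suml.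
apply: eq_bigr => w _; rewrite free_mxU fmM word_mx_cat.
by rewrite -scalemxAl -scalemxAr scalerA mulrC.
Qed.

Lemma free_mx_gen i : free_mx (free_gen i) = g i.
Proof. by rewrite /free_gen -lock free_mxU scale1r fmU /= mul1mx. Qed.

Lemma free_mx_ideal (r : free_alg -> Prop) :
    (forall x, r x -> free_mx x = 0) ->
  forall x, ideal_gen r x -> free_mx x = 0.
Proof.
move=> r0 x; elim=> {x} [x /r0||x y _ IHx _ IHy|u x _ IHx|x u _ IHx] //.
- exact: free_mx0.
- by rewrite free_mxB IHx IHy subrr.
- by rewrite free_mxM IHx mul0mx.
- by rewrite free_mxM IHx mulmx0.
Qed.

End FreeMx.
End FreeAlgebra.

Section A0.
Variable k : fieldType.

(* inl t stands for the symbol H_t, and inr i for the symbol a_i.             *)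
Definition A0_gen : Type := ('S_3 + transposition)%type.
HB.instance Definition _ := Choice.on A0_gen.

Local Notation free_A0 := (free_alg k A0_gen).

Definition fH (t : 'S_3) : free_A0 := free_gen k (inl t : A0_gen).
Definition fa (i : transposition) : free_A0 := free_gen k (inr i : A0_gen).

Inductive A0_rel : free_A0 -> Prop :=
| RelH1 : A0_rel (fH 1%g - 1)
| RelHH t s : A0_rel (fH t * fH s - fH (s * t)%g)
| RelHa t i : A0_rel
    (fH t * fa i - (-1) ^+ odd_perm t *: (fa (conj_transp i t) * fH t))
| Relaa : A0_rel (fa t12 ^+ 2)
| Relaaa : A0_rel (fa t12 * fa t23 + fa t23 * fa t13 + fa t13 * fa t12).

Definition A0 : Type := ring_quot A0_rel.
HB.instance Definition _ := GRing.PzRing.on A0.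
HB.instance Definition _ := GRing.Lmodule.on A0.

Definition A0_pi (x : free_A0) : A0 := quot_pi A0_rel x.

Definition H_ (t : 'S_3) : A0 := A0_pi (fH t).
Definition a_ (i : transposition) : A0 := A0_pi (fa i).

(* The action of A0 attached to a representation of S_3, all a_i acting by 0. *)
Section A0Mx.
Variables (n : nat) (W : mx_representation k [set: 'S_3] n).

Definition gen_mx (x : A0_gen) : 'M[k]_n :=
  match x with inl t => W t | inr _ => 0 end.

Definition A0_mx (x : A0) : 'M[k]_n := free_mx gen_mx (repr (x : ring_quot A0_rel)).

Lemma gen_mx_rel x : A0_rel x -> free_mx gen_mx x = 0.
Proof.
have H0 t : free_mx gen_mx (fH t) = W t by rewrite free_mx_gen.
have a0 i : free_mx gen_mx (fa i) = 0 by rewrite free_mx_gen.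
have mula y i : free_mx gen_mx (y * fa i) = 0 by rewrite free_mxM a0 mul0mx.
have amul y i : free_mx gen_mx (fa i * y) = 0 by rewrite free_mxM a0 mulmx0.
have add0 y z : free_mx gen_mx y = 0 -> free_mx gen_mx z = 0 ->
    free_mx gen_mx (y + z) = 0.
  by move=> y0 z0; rewrite free_mxD y0 z0 addr0.
have subZ0 c y z : free_mx gen_mx y = 0 -> free_mx gen_mx z = 0 ->
    free_mx gen_mx (y - c *: z) = 0.
  by move=> y0 z0; rewrite free_mxB free_mxZ y0 z0 scaler0 subr0.
case=> [|t s|t i||].
- by rewrite free_mxB H0 free_mx1 repr_mx1 subrr.
- by rewrite free_mxB free_mxM !H0 repr_mxM ?inE ?subrr.
- exact: subZ0 (mula _ _) (amul _ _).
- exact: mula.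
- exact: add0 (add0 _ _ (mula _ _) (mula _ _)) (mula _ _).
Qed.

Lemma A0_mx_pi (x : free_A0) : A0_mx (A0_pi x) = free_mx gen_mx x.
Proof.
apply/eqP; rewrite -subr_eq0 -free_mxB; apply/eqP/(free_mx_ideal gen_mx_rel).
exact/quot_piP/quot_reprK.
Qed.

End A0Mx.

Definition triv_fun (t : 'S_3) : 'M[k]_1 := 1%:M.
Lemma triv_mx_repr : mx_repr [set: 'S_3] triv_fun.
Proof. by split=> // s t _ _; rewrite mulmx1. Qed.
Definition W_eps : mx_representation k [set: 'S_3] 1 :=
  MxRepresentation triv_mx_repr.

Definition sgn_fun (t : 'S_3) : 'M[k]_1 := ((-1) ^+ odd_perm t)%:M.
Lemma sgn_mx_repr : mx_repr [set: 'S_3] sgn_fun.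
Proof.
split=> [|s t _ _]; first by rewrite /sgn_fun odd_perm1 expr0.
by rewrite /sgn_fun odd_permM signr_addb scalar_mxM.
Qed.
Definition W_sgn : mx_representation k [set: 'S_3] 1 :=
  MxRepresentation sgn_mx_repr.

(* The permutation representation: the basis vector e_x is sent to e_(t x).   *)
Definition perm_fun (t : 'S_3) : 'M[k]_3 := perm_mx t.
Lemma perm_mx_repr : mx_repr [set: 'S_3] perm_fun.
Proof.
by split=> [|s t _ _]; [exact: perm_mx1 | exact: perm_mxM].
Qed.
Definition W_perm : mx_representation k [set: 'S_3] 3 :=
  MxRepresentation perm_mx_repr.

(* The row vectors of k^3 whose coordinates sum to 0.                         *)
Definition sum0_space : 'M[k]_3 := kermx (const_mx 1 : 'cV[k]_3).

Lemma sum0_spaceP (v : 'rV[k]_3) :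
  reflect (\sum_j v 0 j = 0) (v <= sum0_space)%MS.
Proof.
have E : (v *m (const_mx 1 : 'cV[k]_3)) 0 0 = \sum_j v 0 j.
  by rewrite mxE; apply: eq_bigr => j _; rewrite mxE mulr1.
apply: (iffP sub_kermxP) => [v0|v0]; first by rewrite -E v0 mxE.
by apply/matrixP=> i j; rewrite !ord1 E v0 mxE.
Qed.

Lemma sum0_mxmodule : mxmodule W_perm sum0_space.
Proof.
apply/mxmoduleP=> t _; apply/sub_kermxP.
have -> : (sum0_space *m W_perm t) *m const_mx 1
   = sum0_space *m (const_mx 1 : 'cV[k]_3).
  by rewrite -mulmxA /= /perm_fun -row_permE; congr (_ *m _);
     apply/matrixP=> i j; rewrite !mxE.
exact: mulmx_ker.
Qed.

Definition W_st : mx_representation k [set: 'S_3] (\rank sum0_space) :=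
  submod_repr sum0_mxmodule.

Lemma rank_sum0_space : \rank sum0_space = 2.
Proof.
rewrite mxrank_ker; suff -> : \rank (const_mx 1 : 'cV[k]_3) = 1%N by [].
apply/eqP; rewrite eqn_leq rank_leq_col lt0n mxrank_eq0.
by apply/eqP=> /matrixP/(_ 0 0); rewrite !mxE => /eqP; rewrite oner_eq0.
Qed.

Lemma A0_oner_neq0 : (1 : A0) != 0.
Proof.
apply/eqP=> A01; have : A0_mx W_eps (A0_pi 1) = A0_mx W_eps (A0_pi 0).
  by congr A0_mx; apply: etrans A01 _; rewrite /A0_pi quot_pi0.
rewrite !A0_mx_pi free_mx0 free_mx1 => /matrixP/(_ 0 0).
by rewrite !mxE => /eqP; rewrite oner_eq0.
Qed.

HB.instance Definition _ := GRing.PzSemiRing_isNonZero.Build A0 A0_oner_neq0.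
HB.instance Definition _ :=
  GRing.Lmodule_isLalgebra.Build k A0 (@quot_scalerAl k _ A0_rel).
HB.instance Definition _ :=
  GRing.Lalgebra_isAlgebra.Build k A0 (@quot_scalerAr k _ A0_rel).

Lemma A0_pi_surj (x : A0) : exists y, x = A0_pi y.
Proof. exact: quot_pi_surj. Qed.

Lemma A0_piD x y : A0_pi (x + y) = A0_pi x + A0_pi y.
Proof. exact: quot_piD. Qed.

Lemma A0_piB x y : A0_pi (x - y) = A0_pi x - A0_pi y.
Proof. exact: quot_piB. Qed.

Lemma A0_piM x y : A0_pi (x * y) = A0_pi x * A0_pi y.
Proof. exact: quot_piM. Qed.

Lemma A0_piZ c x : A0_pi (c *: x) = c *: A0_pi x.
Proof. exact: quot_piZ. Qed.

Lemma A0_pi1 : A0_pi 1 = 1.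
Proof. by []. Qed.

Lemma A0_pi_rel x : A0_rel x -> A0_pi x = 0.
Proof. exact: quot_pi_rel. Qed.

Lemma H_1 : H_ 1%g = 1.
Proof.
by apply/eqP; rewrite -subr_eq0 -A0_pi1 -A0_piB; apply/eqP/A0_pi_rel/RelH1.
Qed.

Lemma H_M t s : H_ t * H_ s = H_ (s * t)%g.
Proof.
by apply/eqP; rewrite -subr_eq0 -A0_piM -A0_piB; apply/eqP/A0_pi_rel/RelHH.
Qed.

Lemma H_a t i :
  H_ t * a_ i = (-1) ^+ odd_perm t *: (a_ (conj_transp i t) * H_ t).
Proof.
apply/eqP; rewrite -subr_eq0 -!A0_piM -A0_piZ -A0_piB.
exact/eqP/A0_pi_rel/RelHa.
Qed.

Lemma a12_sqr : a_ t12 ^+ 2 = 0.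
Proof. by rewrite expr2 -A0_piM; apply/A0_pi_rel/Relaa. Qed.

Lemma a12_a23_a13 : a_ t12 * a_ t23 + a_ t23 * a_ t13 + a_ t13 * a_ t12 = 0.
Proof. by rewrite -!A0_piM -!A0_piD; apply/A0_pi_rel/Relaaa. Qed.

(* The extension by zero of a kS_3-module to an A0-module.                    *)
Definition ext_module n (W : mx_representation k [set: 'S_3] n) : Type :=
  'rV[k]_n.

Section ExtModule.
Variables (n : nat) (W : mx_representation k [set: 'S_3] n).

HB.instance Definition _ := GRing.Zmodule.copy (ext_module W) 'rV[k]_n.

Definition ext_scale (x : A0) (v : ext_module W) : ext_module W :=
  (v : 'rV[k]_n) *m A0_mx W x.

Lemma ext_scale_pi x v : ext_scale (A0_pi x) v = (v : 'rV[k]_n) *m free_mx (gen_mx W) x.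
Proof. by rewrite /ext_scale A0_mx_pi. Qed.

Lemma ext_scaleA x y v : ext_scale x (ext_scale y v) = ext_scale (x * y) v.
Proof.
have [[x' ->] [y' ->]] := (A0_pi_surj x, A0_pi_surj y).
by rewrite -A0_piM !ext_scale_pi free_mxM mulmxA.
Qed.

Lemma ext_scale1 : left_id 1 ext_scale.
Proof. by move=> v; rewrite -A0_pi1 ext_scale_pi free_mx1 mulmx1. Qed.

Lemma ext_scaleDr : right_distributive ext_scale +%R.
Proof. by move=> x u v; rewrite /ext_scale mulmxDl. Qed.

Lemma ext_scaleDl v : {morph ext_scale^~ v : x y / x + y}.
Proof.
move=> x y; have [[x' ->] [y' ->]] := (A0_pi_surj x, A0_pi_surj y).
by rewrite -A0_piD !ext_scale_pi free_mxD mulmxDr.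
Qed.

HB.instance Definition _ := GRing.Zmodule_isLmodule.Build A0 (ext_module W)
  ext_scaleA ext_scale1 ext_scaleDr ext_scaleDl.

Lemma ext_H t (v : ext_module W) : H_ t *: v = (v : 'rV[k]_n) *m W t.
Proof. by rewrite [LHS]ext_scale_pi free_mx_gen. Qed.

Lemma ext_a i (v : ext_module W) : a_ i *: v = 0.
Proof. by rewrite [LHS]ext_scale_pi free_mx_gen mulmx0. Qed.

Lemma ext_scalar c (v : ext_module W) : c%:A *: v = c *: (v : 'rV[k]_n).
Proof.
by rewrite -A0_pi1 -A0_piZ [LHS]ext_scale_pi free_mxZ free_mx1 -scalemxAr mulmx1.
Qed.

End ExtModule.

Definition S_eps : lmodType A0 := ext_module W_eps.
Definition S_sgn : lmodType A0 := ext_module W_sgn.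
Definition S_st : lmodType A0 := ext_module W_st.

End A0.

(* {pred M} is no restriction on subsets: boolp makes every Prop decidable.   *)
Definition simple_module (A : pzRingType) (M : lmodType A) : Prop :=
  (exists v : M, v != 0) /\
  forall U : {pred M}, submod_closed U -> U =i [pred v | v == 0] \/ U =i predT.

Definition isomorphic_modules (A : pzRingType) (M N : lmodType A) : Prop :=
  exists f : {linear M -> N}, bijective f.

(* Main.v *)
(* Let x, y, z be the images of a_12, a_23, a_13. Conjugating the relations by *)
(* the H_t gives x^2 = y^2 = z^2 = 0 and yx + zy + xz = 0, whence the braid    *)
(* relation xyx = yxy. So for v <> 0 one of xyx v, xy v, yx v, x v, y v, v is  *)
(* a nonzero w killed by x and y, and the two quadratic relations then show    *)
(* that zw is also killed by x and y: either w or zw is a nonzero vector       *)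
(* killed by every a_i. The vectors killed by all the a_i form a submodule, so *)
(* the a_i act by zero on a simple module M. For v in M, the vectors           *)
(* w_j = sum_(t 3 = j) H_t v are permuted by the H_t. If w_3 <> 0 for some v,  *)
(* they define a nonzero map from the permutation representation to M, which   *)
(* yields a nonzero map from S_eps (through the sum of the w_j) or from S_st.  *)
(* Otherwise v + H_(12) v = w_3 = 0 for all v and M is a sign module.          *)

Require Import Defs.
From HB Require Import structures.
From mathcomp Require Import finmap monalg mxrepresentation.
From mathcomp Require boolp.
From mathcomp Require Import all_boot all_order all_fingroup all_algebra.

Set Implicit Arguments.
Unset Strict Implicit.
Unset Printing Implicit Defensive.

Import GRing.Theory.
Local Open Scope ring_scope.

(** On a simple module the [a_i] die, and what remains is the representation theory of the symmetric
    group. By [annihilated_vector] some nonzero vector is killed by all [a_i]; such vectors form a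
    submodule, since conjugation by [H_t] permutes the [a_i] up to sign, whence [a_eq0_of_simple].
    Schur's lemma ([nonzero_hom_bij]) reduces [simple_A0_module] to one nonzero map from a candidate
    into M. As M is not known to be finite-dimensional, [ext_hom] builds such maps from explicit
    vectors. The candidates are simple by [ext_dim1_simple] and [S_st_simple]. A transposition
    separates [S_eps] from [S_sgn], and a 3-cycle separates [S_st] from both. *)

(** * Reduction to generators of the algebra *)

(** Every element is a combination of images of words in the generators; scalar multiples are
    covered by products with [c%:A]. *)
Lemma A0_ind (k : fieldType) (P : A0 k -> Prop) :
    (forall c, P c%:A) -> (forall t, P (H_ k t)) -> (forall i, P (a_ k i)) ->
    (forall x y, P x -> P y -> P (x + y)) ->
    (forall x y, P x -> P y -> P (x * y)) ->
  forall x, P x.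
Proof.
move=> Pc PH Pa PD PM x; have [y ->] := A0_pi_surj x.
have P0 : P (A0_pi 0).
  by rewrite /A0_pi quot_pi0 -(scale0r (1 : A0 k)); apply: Pc.
have Pw (w : seq (A0_gen)) : P (A0_pi (<< FMonom w >> : free_alg k A0_gen)).
  elim: w => [|i w IHw].
    by have := Pc 1; rewrite scale1r -fmoneE.
  have -> : << FMonom (i :: w) >> = free_gen k i * << FMonom w >>
      :> free_alg k A0_gen.
    rewrite /free_gen -lock [RHS]malgM_def fgmulUU mulr1.
    by congr << _ >>; apply: val_inj; rewrite /= fmM fmuE.
  rewrite A0_piM; apply: PM => //; case: i => [t|i]; [exact: PH|exact: Pa].
have -> : y = \sum_(w <- msupp y) mcoeff w y *: (<< w >> : free_alg k A0_gen).
  rewrite [LHS]monalgE; apply: eq_bigr => w _; apply/malgP=> v.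
  by rewrite [RHS]mcoeffZ !mcoeffU mulrnAr mulr1.
elim/big_rec: _ => // w z _ Pz; rewrite A0_piD; apply: PD => //.
rewrite A0_piZ -[A0_pi _]mul1r scalerAl; apply: PM; first exact: Pc.
by case: w.
Qed.

Lemma A0_scalarC (k : fieldType) (c : k) (x : A0 k) : c%:A * x = x * c%:A.
Proof. by rewrite -scalerAl -scalerAr mul1r mulr1. Qed.

(* M and N carry no k-structure of their own: c in k acts as c%:A.            *)
Lemma scalable_on_generators (k : fieldType) (M N : lmodType (A0 k))
    (f : M -> N) :
    {morph f : u v / u + v} ->
    (forall (c : k) v, f (c%:A *: v) = c%:A *: f v) ->
    (forall t v, f (H_ k t *: v) = H_ k t *: f v) ->
    (forall i v, f (a_ k i *: v) = a_ k i *: f v) ->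
  scalable f.
Proof.
move=> fD fc fH fa; elim/A0_ind => // x y fx fy v.
- by rewrite !scalerDl fD fx fy.
- by rewrite -!scalerA fx fy.
Qed.

(** * Schur's lemma and simple modules *)

Lemma nonzero_hom_bij (A : pzRingType) (M N : lmodType A)
    (f : {linear M -> N}) v :
  simple_module M -> simple_module N -> f v != 0 -> bijective f.
Proof.
move=> [_ simM] [_ simN] fv0.
have kerf : submod_closed [pred u | f u == 0].
  split=> [|x u w]; rewrite !inE ?linear0 // linearP => /eqP-> /eqP->.
  by rewrite scaler0 addr0.
have imf : submod_closed [pred w | boolp.asbool (exists u, f u == w)].
  split=> [|x u w]; rewrite ?inE.
    by apply/boolp.asboolP; exists 0; rewrite linear0.
  move=> /boolp.asboolP[u' /eqP<-] /boolp.asboolP[w' /eqP<-].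
  apply/boolp.asboolP.
  by exists (x *: u' + w'); rewrite linearP.
have fI : injective f.
  case: (simM _ kerf) => [ker0|/(_ v)]; last by rewrite !inE (negPf fv0).
  apply: raddf_inj => u /eqP fu0; have := ker0 u.
  by rewrite !inE fu0 => /esym/eqP.
have fS w : exists u, f u == w.
  case: (simN _ imf) => [/(_ (f v))|/(_ w)]; last first.
    by rewrite !inE => /boolp.asboolP.
  rewrite !inE (negPf fv0) => /negP[]; apply/boolp.asboolP.
  by exists v.
exists (fun w => xchoose (fS w)) => [u|w]; last exact/eqP/(xchooseP (fS w)).
exact/fI/eqP/(xchooseP (fS (f u))).
Qed.

Lemma simple_moduleI (A : pzRingType) (M : lmodType A) :
    (exists v : M, v != 0) ->
    (forall (U : {pred M}) v, submod_closed U -> v \in U -> v != 0 ->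
       forall u, u \in U) ->
  simple_module M.
Proof.
move=> M0 genM; split=> // U Uclosed; have [U0 _] := Uclosed.
case: (boolp.EM (exists2 v, v \in U & v != 0)) => [[v Uv v0]|noU]; [right|left].
  by move=> u; rewrite inE; apply: genM v0 u.
move=> v; rewrite inE; apply/idP/eqP => [Uv|-> //].
by apply/eqP; apply: contra_notT noU => v0; exists v.
Qed.

Lemma isomorphic_sym (A : pzRingType) (M N : lmodType A) :
  isomorphic_modules M N -> isomorphic_modules N M.
Proof.
case=> f [g fK gK].
have gP : linear g by move=> x u v; apply: (can_inj fK); rewrite linearP !gK.
pose gL := GRing.isLinear.Build A N M _ g gP.
pose h : {linear N -> M} := HB.pack g gL.
by exists h, f.
Qed.

(** * Vanishing of the [a_i] on simple modules *)

Lemma annihilated_vector (A : pzRingType) (M : lmodType A) (x y z : A) (v : M) :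
    x * x = 0 -> y * y = 0 -> z * z = 0 ->
    x * y + y * z + z * x = 0 -> y * x + z * y + x * z = 0 -> v != 0 ->
  exists2 w : M, w != 0 & [/\ x *: w = 0, y *: w = 0 & z *: w = 0].
Proof.
move=> xx yy zz rel1 rel2 v0.
have braid : x * y * x = y * x * y.
  (* Both sides become 0: the left is [rel1] times x, the right is y times [rel1], once the squares
     vanish. *)
  apply: (addIr (y * z * x)).
  have /eqP := congr1 ( *%R^~ x) rel1; have /eqP := congr1 ( *%R y) rel1.
  rewrite !mulrDr !mulrDl !mulrA yy -(mulrA z) xx !mulr0 !mul0r !addr0.
  by move=> /eqP-> /eqP->.
have [w w0 [xw yw]] : exists2 w : M, w != 0 & x *: w = 0 /\ y *: w = 0.
  have [xv|xv] := eqVneq (x *: v) 0; have [yv|yv] := eqVneq (y *: v) 0.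
  - by exists v.
  - have [xyv|xyv] := eqVneq ((x * y) *: v) 0.
      by exists (y *: v); rewrite // !scalerA xyv yy scale0r.
    exists ((x * y) *: v) => //.
    by rewrite !scalerA !mulrA xx -braid -(scalerA _ x) xv mul0r scale0r scaler0.
  - have [yxv|yxv] := eqVneq ((y * x) *: v) 0.
      by exists (x *: v); rewrite // !scalerA yxv xx scale0r.
    exists ((y * x) *: v) => //.
    by rewrite !scalerA !mulrA yy braid -(scalerA _ y) yv mul0r scale0r scaler0.
  have [xyxv|xyxv] := eqVneq ((x * y * x) *: v) 0; last first.
    exists ((x * y * x) *: v) => //.
    rewrite scalerA !mulrA xx !mul0r scale0r; split=> //.
    by rewrite braid scalerA !mulrA yy !mul0r scale0r.
  have [yxv|yxv] := eqVneq ((y * x) *: v) 0.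
    by exists (x *: v); rewrite // !scalerA yxv xx scale0r.
  exists ((y * x) *: v) => //.
  by rewrite !scalerA !mulrA yy xyxv mul0r scale0r.
have [zw|zw] := eqVneq (z *: w) 0; first by exists w.
(* Applied to w, [rel2] leaves only xzw = 0 and [rel1] leaves only yzw = 0. *)
exists (z *: w) => //; rewrite !scalerA zz scale0r; split=> //.
  have := congr1 ( *:%R^~ w) rel2.
  by rewrite /= !scalerDl -!scalerA xw yw !scaler0 !add0r scale0r.
have := congr1 ( *:%R^~ w) rel1.
by rewrite /= !scalerDl -!scalerA xw yw !scaler0 addr0 add0r scale0r.
Qed.

Lemma ord3P (j : 'I_3) : [\/ j = pt1, j = pt2 | j = pt3].
Proof.
by case: j => [[|[|[]]]] // ?; [apply: Or31 | apply: Or32 | apply: Or33];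
   apply: val_inj.
Qed.

Lemma transpositionP (i : transposition) : [\/ i = t12, i = t13 | i = t23].
Proof.
case: i => s ps; case/existsP: (ps) => x /existsP[y /andP[xy /eqP Es]].
suff: [\/ s = tperm pt1 pt2, s = tperm pt1 pt3 | s = tperm pt2 pt3].
  by case=> E; [apply: Or31|apply: Or32|apply: Or33]; apply: val_inj.
rewrite {}Es; case: (ord3P x) (ord3P y) xy => -> [] -> // _;
  by [apply: Or31 | apply: Or32 | apply: Or33 | rewrite tpermC; apply: Or31
     | rewrite tpermC; apply: Or32 | rewrite tpermC; apply: Or33].
Qed.

Lemma conj_t12_23 : conj_transp t12 (tperm pt2 pt3) = t13.
Proof. by apply: val_inj; rewrite /= tpermJ tpermL tpermD. Qed.

Lemma conj_t23_23 : conj_transp t23 (tperm pt2 pt3) = t23.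
Proof. by apply: val_inj; rewrite /= tpermJ tpermL tpermR tpermC. Qed.

Lemma conj_t13_23 : conj_transp t13 (tperm pt2 pt3) = t12.
Proof. by apply: val_inj; rewrite /= tpermJ tpermR tpermD. Qed.

Lemma conj_t12_13 : conj_transp t12 (tperm pt1 pt3) = t23.
Proof. by apply: val_inj; rewrite /= tpermJ tpermL tpermD // tpermC. Qed.

Lemma a_conj (k : fieldType) t i :
  a_ k (conj_transp i t) = (-1) ^+ odd_perm t *: (H_ k t * a_ k i * H_ k t^-1).
Proof.
rewrite H_a -scalerAl scalerA -expr2 sqrr_sign scale1r.
by rewrite -mulrA H_M mulVg H_1 mulr1.
Qed.

(** The two signs cancel, so conjugation by [H_t] turns each quadratic relation into its
    relabelling. This produces the relations beyond the two defining ones. *)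
Lemma aM_conj (k : fieldType) t i j :
  a_ k (conj_transp i t) * a_ k (conj_transp j t) =
  H_ k t * (a_ k i * a_ k j) * H_ k t^-1.
Proof.
rewrite !a_conj -scalerAl -scalerAr scalerA -expr2 sqrr_sign scale1r.
by rewrite !mulrA -(mulrA _ _ (H_ k t)) H_M mulgV H_1 mulr1.
Qed.

Lemma a_eq0_of_simple (k : fieldType) (M : lmodType (A0 k)) :
  simple_module M -> forall i (v : M), a_ k i *: v = 0.
Proof.
case=> [[v v0] simM].
pose U := [pred u : M | boolp.asbool (forall i, a_ k i *: u = 0)].
have UP u : reflect (forall i, a_ k i *: u = 0) (u \in U).
  exact: boolp.asboolP.
have U_stable x : forall u, u \in U -> x *: u \in U.
  elim/A0_ind: x => [c|t|j|x y Ux Uy|x y Ux Uy] u Uu.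
  - by apply/UP=> i; rewrite scalerA -A0_scalarC -scalerA (UP _ Uu) scaler0.
  (* Writing i as the conjugate by t of some j lets [a_i] pass to the right of [H_t], where it
     becomes [a_j] up to sign and kills u. *)
  - apply/UP=> i; have <- : conj_transp (conj_transp i t^-1%g) t = i.
      by apply: val_inj; rewrite /= conjgKV.
    rewrite a_conj scalerA -scalerAl -(mulrA _ (H_ k t^-1)) H_M mulgV H_1 mulr1.
    by rewrite scalerAl -scalerA (UP _ Uu) scaler0.
  - by apply/UP=> i; rewrite (UP _ Uu) scaler0.
  - apply/UP=> i.
    by rewrite scalerDl scalerDr (UP _ (Ux _ Uu)) (UP _ (Uy _ Uu)) addr0.
  - by rewrite -scalerA; apply/Ux/Uy.
have Uclosed : submod_closed U.
  split=> [|x u w Uu Uw]; apply/UP=> i; first by rewrite scaler0.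
  by rewrite scalerDr (UP _ Uw) (UP _ (U_stable x u Uu)) addr0.
have aa12 : a_ k t12 * a_ k t12 = 0 by rewrite -expr2 a12_sqr.
have aa23 : a_ k t23 * a_ k t23 = 0.
  by rewrite -conj_t12_13 aM_conj aa12 mulr0 mul0r.
have aa13 : a_ k t13 * a_ k t13 = 0.
  by rewrite -conj_t12_23 aM_conj aa12 mulr0 mul0r.
(* Conjugation by (2 3) swaps the labels 12 and 13 and fixes 23, which yields the three products in
   reversed order. *)
have rel2 : a_ k t23 * a_ k t12 + a_ k t13 * a_ k t23 + a_ k t12 * a_ k t13 = 0.
  have := congr1 (fun u => H_ k (tperm pt2 pt3) * u * H_ k (tperm pt2 pt3)^-1)
                 (a12_a23_a13 k).
  rewrite !mulrDr !mulrDl -!aM_conj conj_t12_23 conj_t23_23 conj_t13_23.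
  by rewrite mulr0 mul0r addrAC addrC addrA.
have [w w0 [w12 w23 w13]] :=
  annihilated_vector aa12 aa23 aa13 (a12_a23_a13 k) rel2 v0.
have Uw : w \in U by apply/UP=> i; case: (transpositionP i) => ->.
case: (simM _ Uclosed) => [/(_ w)|Uall i u].
  by rewrite Uw inE (negPf w0).
by apply: (UP u); rewrite Uall.
Qed.

(** * Maps out of extensions by zero *)

Lemma A0_scalar_eq0 (k : fieldType) (M : lmodType (A0 k)) (c : k) (v : M) :
  c != 0 -> c%:A *: v = 0 -> v = 0.
Proof.
move=> c0 /(congr1 ( *:%R c^-1%:A)).
by rewrite scalerA -scalerAl mul1r scalerA mulVf // !scale1r scaler0.
Qed.

(** Reconciles a sign coming from a matrix entry in k with the sign taken in [A0]. *)
Lemma A0_sign_scale (k : fieldType) (M : lmodType (A0 k)) (b : bool) (v : M) :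
  ((-1) ^+ b : k)%:A *: v = (-1) ^+ b *: v.
Proof. by case: b; rewrite ?scaleN1r ?expr1 ?expr0 ?scale1r. Qed.

Lemma ext_hom (k : fieldType) n (W : mx_representation k [set: 'S_3] n)
    (M : lmodType (A0 k)) (w : 'I_n -> M) :
    (forall t j, H_ k t *: w j = \sum_l (W t j l)%:A *: w l) ->
    (forall i j, a_ k i *: w j = 0) ->
  exists f : {linear ext_module W -> M},
    forall u : 'rV[k]_n, f u = \sum_j (u 0 j)%:A *: w j.
Proof.
move=> Hw aw.
pose f (u : ext_module W) := \sum_j ((u : 'rV[k]_n) 0 j)%:A *: w j.
have fD : {morph f : u v / u + v}.
  move=> u v; rewrite /f -big_split; apply: eq_bigr => j _ /=.
  by rewrite mxE scalerDl scalerDl.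
have fZ : scalable f.
  apply: scalable_on_generators => // [c u|t u|i u].
  - rewrite (ext_scalar c u) /f [RHS]scaler_sumr; apply: eq_bigr => j _.
    by rewrite [RHS]scalerA -scalerAl mul1r scalerA mxE.
  - rewrite ext_H /f scaler_sumr.
    under [RHS]eq_bigr do rewrite scalerA -A0_scalarC -scalerA Hw scaler_sumr.
    rewrite exchange_big; apply: eq_bigr => l _ /=.
    rewrite mxE !scaler_suml; apply: eq_bigr => j _.
    by rewrite [RHS]scalerA -scalerAl mul1r scalerA.
  rewrite ext_a /f scaler_sumr.
  rewrite big1 => [|j _]; last by rewrite mxE scale0r scale0r.
  by rewrite big1 // => j _; rewrite scalerA -A0_scalarC -scalerA aw scaler0.
have fP : linear f by move=> x u v; rewrite fD fZ.
pose g : {linear ext_module W -> M} :=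
  HB.pack f (GRing.isLinear.Build (A0 k) (ext_module W) M _ f fP).
by exists g.
Qed.

(** Lets [S_st] reach M through the permutation representation, whose basis is explicit. *)
Lemma ext_val_submod (k : fieldType) n (W : mx_representation k [set: 'S_3] n)
    (U : 'M[k]_n) (modU : mxmodule W U) :
  exists f : {linear ext_module (submod_repr modU) -> ext_module W},
    forall u : 'rV[k]_(\rank U), f u = val_submod u.
Proof.
pose f (u : ext_module (submod_repr modU)) : ext_module W :=
  val_submod (u : 'rV[k]_(\rank U)).
have fD : {morph f : u v / u + v} by move=> u v; apply: linearD.
have fZ : scalable f.
  apply: scalable_on_generators => // [c u|t u|i u].
  - by rewrite !ext_scalar /f linearZ.
  - by rewrite !ext_H /f val_submodJ ?inE.
  by rewrite !ext_a /f linear0.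
have fP : linear f by move=> x u v; rewrite fD fZ.
pose g : {linear ext_module (submod_repr modU) -> ext_module W} :=
  HB.pack f (GRing.isLinear.Build (A0 k) _ (ext_module W) _ f fP).
by exists g.
Qed.

(** * Simplicity of the three modules *)

Lemma ext_dim1_simple (k : fieldType) (W : mx_representation k [set: 'S_3] 1) :
  simple_module (ext_module W).
Proof.
apply: simple_moduleI.
  exists (const_mx 1 : 'rV[k]_1); apply/eqP => /matrixP/(_ 0 0).
  by rewrite !mxE => /eqP; rewrite oner_eq0.
move=> U v [U0 UZD] Uv v0 u.
have v00 : (v : 'rV[k]_1) 0 0 != 0.
  apply: contraNneq v0 => v00; apply/eqP/matrixP=> i j.
  by rewrite !ord1 v00 mxE.
have -> : u = ((u : 'rV[k]_1) 0 0 / (v : 'rV[k]_1) 0 0)%:A *: v; last first.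
  by rewrite -[_ *: _]addr0; apply: UZD.
rewrite ext_scalar; apply/matrixP=> i j.
by rewrite !ord1 mxE mulfVK.
Qed.

Lemma delta_perm (k : fieldType) (t : 'S_3) (i : 'I_3) :
  (delta_mx 0 i : 'rV[k]_3) *m W_perm k t = delta_mx 0 (t i).
Proof.
by rewrite -rowE; apply/rowP=> j; rewrite !mxE eqxx eq_sym.
Qed.

Lemma delta_sub_sum0 (k : fieldType) (i j : 'I_3) :
  ((delta_mx 0 i : 'rV[k]_3) - delta_mx 0 j <= sum0_space k)%MS.
Proof.
have sum_delta (l : 'I_3) : \sum_m (delta_mx 0 l : 'rV[k]_3) 0 m = 1.
  rewrite (bigD1 l) //= mxE !eqxx big1 ?addr0 // => m /negPf ml.
  by rewrite mxE ml andbF.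
apply/sum0_spaceP; under eq_bigr do rewrite mxE [X in _ + X]mxE.
by rewrite sumrB !sum_delta subrr.
Qed.

(** A nonzero sum-zero vector is not constant when 3 is invertible, so some transposition moves it
    and puts a difference e_i - e_j in the submodule. Double transitivity then gives all such
    differences, and they span. *)
Lemma S_st_simple (k : fieldType) : 3%:R != 0 :> k -> simple_module (S_st k).
Proof.
move=> three0; set V := sum0_space k.
pose d (i j : 'I_3) : 'rV[k]_3 := delta_mx 0 i - delta_mx 0 j.
have dV i j : (d i j <= V)%MS by apply: delta_sub_sum0.
apply: simple_moduleI.
  exists (in_submod V (d pt1 pt2)); apply/eqP => /(congr1 val_submod).
  rewrite in_submodK // linear0 => /matrixP/(_ 0 pt1).
  by rewrite !mxE /= subr0 => /eqP; rewrite oner_eq0.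
move=> U v [U0 UZD] Uv v0 u.
(* Membership in U is read in the ambient k^3, where permutations act on coordinates; [in_submod]
   inverts [val_submod] on V only, hence the condition in [PJ]. *)
pose P (x : 'rV[k]_3) : bool := (in_submod V x : S_st k) \in U.
have PZ c x : P x -> P (c *: x).
  move=> Px; rewrite /P linearZ -[X in X \in U](@ext_scalar k _ (W_st k)).
  by rewrite -[_ *: _]addr0; apply: UZD.
have PD x y : P x -> P y -> P (x + y).
  by move=> Px Py; rewrite /P linearD; have := UZD 1 _ _ Px Py; rewrite scale1r.
have PB x y : P x -> P y -> P (x - y).
  by move=> Px Py; rewrite -scaleN1r; apply/PD/PZ.
have PJ t x : (x <= V)%MS -> P x -> P (x *m W_perm k t).
  move=> Vx Px; rewrite /P (in_submodJ (sum0_mxmodule k)) //.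
  rewrite -[X in X \in U](@ext_H k _ (W_st k)).
  by rewrite -[_ *: _]addr0; apply: UZD.
pose x : 'rV[k]_3 := val_submod (v : 'rV[k]_(\rank V)).
have Vx : (x <= V)%MS by apply: val_submodP.
have Px : P x by rewrite /P val_submodK.
have [i [j [ij xij]]] : exists i j, i != j /\ x 0 i != x 0 j.
  case: (eqVneq (x 0 pt1) (x 0 pt2)) => [x12|]; last by exists pt1, pt2.
  case: (eqVneq (x 0 pt1) (x 0 pt3)) => [x13|]; last by exists pt1, pt3.
  case/negP: v0; rewrite -(val_submod_eq0 (v : 'rV[k]_(\rank V))) -/x.
  have xE l : x 0 l = x 0 pt1 by case: (ord3P l) => ->.
  have /sum0_spaceP := Vx; under eq_bigr do rewrite xE.
  rewrite sumr_const card_ord -mulr_natl => /eqP.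
  rewrite mulf_eq0 (negPf three0) /= => /eqP x0.
  by apply/eqP/rowP=> l; rewrite xE x0 mxE.
clearbody x.
(* x - (i j) x = (x_i - x_j) (e_i - e_j).                                     *)
have Pd_ij : P (d i j).
  have -> : d i j = (x 0 i - x 0 j)^-1 *: (x - x *m W_perm k (tperm i j)).
    apply: (canRL (scalerK _)); first by rewrite subr_eq0.
    apply/rowP=> l; rewrite /= /perm_fun -[tperm i j]invgK -col_permE tpermV.
    rewrite !mxE !eqxx /=.
    case: tpermP => [->|->|/eqP/negPf-> /eqP/negPf->].
    - by rewrite eqxx (negPf ij) subr0 mulr1.
    - by rewrite eqxx eq_sym (negPf ij) sub0r mulrN1 opprB.
    by rewrite !subrr mulr0.
  by apply/PZ/PB=> //; apply: PJ.
have Pd i' j' : P (d i' j').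
  have [->|ij'] := eqVneq i' j'.
    by rewrite /d subrr -(scale0r x); apply: PZ.
  (* The first factor sends i to i'; the second fixes i' and sends the image of j to j'. *)
  pose t := (tperm i i' * tperm (tperm i i' j) j')%g.
  have -> : d i' j' = d i j *m W_perm k t; last exact: PJ.
  have ti' : tperm i i' j != i'.
    by rewrite -[X in _ != X](tpermL i i') (inj_eq perm_inj) eq_sym.
  by rewrite mulmxBl !delta_perm !permM !tpermL (tpermD ti') // eq_sym.
have -> : u = in_submod V (val_submod (u : 'rV[k]_(\rank V))).
  by rewrite val_submodK.
have /sum0_spaceP sum0 := val_submodP (u : 'rV[k]_(\rank V)).
rewrite -/(P _) [X in P X]row_sum_delta.
(* The coordinates sum to 0, so subtracting e_1 from each basis vector changes nothing. *)
have -> : \sum_l val_submod (u : 'rV[k]_(\rank V)) 0 l *: delta_mx 0 l =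
    \sum_l val_submod (u : 'rV[k]_(\rank V)) 0 l *: d l pt1.
  under [RHS]eq_bigr do rewrite scalerBr.
  by rewrite sumrB -scaler_suml sum0 scale0r subr0.
elim/big_ind: _ => // [|l _]; first by rewrite -(scale0r x); apply: PZ.
exact/PZ.
Qed.

(** * Pairwise non-isomorphism *)

Lemma isomorphic_act (A : pzRingType) (M N : lmodType A) (x y : A) :
  isomorphic_modules M N -> (forall v : M, x *: v = y *: v) ->
  forall v : N, x *: v = y *: v.
Proof.
by case=> f [g _ gK] xy v; rewrite -[v]gK -!linearZ /= xy.
Qed.

Lemma ext_dim1_act (k : fieldType) (W : mx_representation k [set: 'S_3] 1) t c
    (v : ext_module W) :
  W t = c%:M -> H_ k t *: v = c%:A *: v.
Proof. by move=> Wt; rewrite ext_H ext_scalar Wt mul_mx_scalar. Qed.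

(** An even element: it acts as 1 on [S_eps] and [S_sgn], but not on [S_st]. *)
Definition cycle123 : 'S_3 := (tperm pt1 pt2 * tperm pt2 pt3)%g.

Lemma S_st_cycle_nontriv (k : fieldType) :
  ~ forall v : S_st k, H_ k cycle123 *: v = 1%:A *: v.
Proof.
pose d : 'rV[k]_3 := delta_mx 0 pt1 - delta_mx 0 pt2.
have dV : (d <= sum0_space k)%MS by apply: delta_sub_sum0.
move=> /(_ (in_submod (sum0_space k) d)); rewrite ext_H scale1r scale1r.
rewrite -(in_submodJ (sum0_mxmodule k)) // => /(congr1 val_submod).
rewrite !in_submodK ?(mxmodule_trans (sum0_mxmodule k)) ?inE //.
rewrite mulmxBl !delta_perm !permM tpermL tpermR tpermL tpermD //.
(* The cycle sends e_1 - e_2 to e_3 - e_1; the second coordinates are -1 and 0. *)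
move=> /matrixP/(_ 0 pt2); rewrite !mxE /= subrr sub0r => /eqP.
by rewrite eq_sym oppr_eq0 oner_eq0.
Qed.

Lemma S_eps_act (k : fieldType) t (v : S_eps k) : H_ k t *: v = 1%:A *: v.
Proof. exact: ext_dim1_act. Qed.

Lemma S_sgn_act (k : fieldType) t (v : S_sgn k) :
  H_ k t *: v = ((-1) ^+ odd_perm t)%:A *: v.
Proof. exact: ext_dim1_act. Qed.

Lemma scalars_acting_equally (k : fieldType) (M : lmodType (A0 k)) (x : A0 k)
    (b c : k) (v : M) :
  b != c -> x *: v = b%:A *: v -> x *: v = c%:A *: v -> v = 0.
Proof.
rewrite -subr_eq0 => bc xb xc; apply: (A0_scalar_eq0 bc).
have -> : (b - c)%:A = b%:A - c%:A :> A0 k by apply: scalerBl.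
have -> : (b%:A - c%:A) *: v = b%:A *: v - c%:A *: v by apply: scalerBl.
by apply/eqP; rewrite subr_eq0; apply/eqP; apply: etrans (esym xb) xc.
Qed.

Lemma S_eps_S_sgn (k : fieldType) :
  2%:R != 0 :> k -> ~ isomorphic_modules (S_eps k) (S_sgn k).
Proof.
move=> two0 /isomorphic_act iso.
have sgnN1 : 1 != (-1) ^+ odd_perm (tperm pt1 pt2) :> k.
  by rewrite odd_tperm expr1 -subr_eq0 opprK -[1 + 1](natrD _ 1 1).
have := scalars_acting_equally sgnN1 (iso _ _ (@S_eps_act k _) _)
  (@S_sgn_act k _ _).
move=> /(_ (const_mx 1 : 'rV[k]_1)) /matrixP/(_ 0 0); rewrite !mxE => /eqP.
by rewrite oner_eq0.
Qed.

Lemma S_eps_S_st (k : fieldType) : ~ isomorphic_modules (S_eps k) (S_st k).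
Proof.
by move=> /isomorphic_act iso; apply/S_st_cycle_nontriv/iso/S_eps_act.
Qed.

Lemma S_sgn_S_st (k : fieldType) : ~ isomorphic_modules (S_sgn k) (S_st k).
Proof.
move=> /isomorphic_act iso; apply/S_st_cycle_nontriv/iso => v.
by rewrite S_sgn_act odd_permM !odd_tperm.
Qed.

(** * Classification of the simple modules *)

Lemma stab_pt3 (t : 'S_3) : (t pt3 == pt3) = (t == 1%g) || (t == tperm pt1 pt2).
Proof.
apply/eqP/orP => [t3|[/eqP->|/eqP->]]; rewrite ?perm1 ?tpermD //.
have t1 : t pt1 != pt3 by rewrite -[X in _ != X]t3 (inj_eq perm_inj).
have t2 : t pt2 != pt3 by rewrite -[X in _ != X]t3 (inj_eq perm_inj).
have t12' : t pt1 != t pt2 by rewrite (inj_eq perm_inj).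
case: (ord3P (t pt1)) (ord3P (t pt2)) t1 t2 t12' => t1 [] t2;
  rewrite t1 t2 // => _ _ _.
  by left; apply/eqP/permP=> j; case: (ord3P j) => ->; rewrite perm1 ?t1 ?t2 ?t3.
right; apply/eqP/permP=> j; case: (ord3P j) => ->.
- by rewrite tpermL.
- by rewrite tpermR.
by rewrite tpermD.
Qed.

(** All transpositions are conjugate to (1 2), so they too act by -1, and they generate the
    group. *)
Lemma sign_act (k : fieldType) (M : lmodType (A0 k)) :
    (forall v : M, H_ k (tperm pt1 pt2) *: v = - v) ->
  forall t (v : M), H_ k t *: v = (-1) ^+ odd_perm t *: v.
Proof.
move=> H12.
have HJ s t : (forall v : M, H_ k s *: v = - v) ->
    forall v : M, H_ k (s ^ t)%g *: v = - v.
  move=> Hs v; rewrite -!H_M -!scalerA Hs scalerN scalerA H_M mulVg H_1.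
  by rewrite scale1r.
have Hi (i : transposition) (v : M) : H_ k (val i) *: v = - v.
  case: (transpositionP i) => -> //.
    by rewrite -conj_t12_23; apply: HJ.
  by rewrite -conj_t12_13; apply: HJ.
move=> t; have [ts -> {t}] := prod_tpermP t.
elim: ts => [_ v|[i j] ts IH /= /andP[/= ij dts] v].
  by rewrite big_nil H_1 odd_perm1.
rewrite big_cons -H_M -scalerA (Hi (swap ij)) scalerN IH //.
rewrite odd_permM odd_tperm /= ij signr_addb.
by rewrite expr1 mulN1r scaleNr.
Qed.

Section PermImage.
Variables (k : fieldType) (M : lmodType (A0 k)) (v : M).

(** The image of e_j under the map from the permutation representation that Frobenius reciprocity
    attaches to v + [H_](1 2) v, a vector fixed by the stabiliser of 3. *)
Definition perm_image (j : 'I_3) : M :=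
  \sum_(s : 'S_3 | s pt3 == j) H_ k s *: v.

Lemma perm_image_act t j : H_ k t *: perm_image j = perm_image (t j).
Proof.
rewrite /perm_image scaler_sumr [RHS](reindex_inj (mulIg t)) /=.
apply: eq_big => [s|s _]; first by rewrite permM (inj_eq perm_inj).
by rewrite scalerA H_M.
Qed.

Lemma perm_image3 : perm_image pt3 = v + H_ k (tperm pt1 pt2) *: v.
Proof.
rewrite /perm_image (eq_bigl _ _ stab_pt3) (bigD1 1%g) ?eqxx //= H_1 scale1r.
congr (_ + _); rewrite (big_pred1 (tperm pt1 pt2)) // => s.
have t1 : tperm pt1 pt2 != 1%g :> 'S_3.
  by apply/eqP=> /(congr1 (@odd_perm _)); rewrite odd_tperm odd_perm1.
by case: (eqVneq s 1%g) => [->|] /=; rewrite ?andbT ?andbF // eq_sym (negPf t1).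
Qed.
End PermImage.

Lemma simple_A0_module (k : fieldType) (M : lmodType (A0 k)) :
  3%:R != 0 :> k -> simple_module M ->
  [\/ isomorphic_modules M (S_eps k), isomorphic_modules M (S_sgn k)
    | isomorphic_modules M (S_st k)].
Proof.
move=> three0 simM; have aM := a_eq0_of_simple simM.
have iso (S : lmodType (A0 k)) (f : {linear S -> M}) u :
    simple_module S -> f u != 0 -> isomorphic_modules M S.
  by move=> simS fu; apply: isomorphic_sym; exists f; apply: nonzero_hom_bij fu.
case: (boolp.EM (exists v : M, perm_image v pt3 != 0)) => [[v w0]|noinv].
  pose w := perm_image v.
  have [|//|f fE] := @ext_hom k 3 (W_perm k) M w.
    move=> t j; rewrite perm_image_act (bigD1 (t j)) //= !mxE eqxx !scale1r.
    rewrite big1 ?addr0 // => l /negPf ltj.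
    by rewrite !mxE eq_sym ltj scale0r scale0r.
  (* A nonzero sum is an invariant vector and gives [S_eps]; a zero sum forces f to be nonzero on
     the sum-zero space. *)
  have [sw|sw] := eqVneq (\sum_j w j) 0; last first.
    apply: Or31.
    have [|//|g gE] := @ext_hom k 1 (W_eps k) M (fun=> \sum_j w j).
      move=> t j; rewrite big_ord1 !ord1 mxE eqxx !scale1r scaler_sumr.
      rewrite [RHS](reindex_inj (@perm_inj _ t)); apply: eq_bigr => l _.
      exact: perm_image_act.
    apply: (iso (S_eps k) g (const_mx 1 : 'rV[k]_1)).
      exact: ext_dim1_simple.
    by rewrite gE big_ord1 mxE !scale1r.
  apply: Or33.
  have [g gE] := ext_val_submod (sum0_mxmodule k).
  pose d j : 'rV[k]_3 := delta_mx 0 pt3 - delta_mx 0 j.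
  have fd j : f (d j) = w pt3 - w j.
    have fdelta l : f (delta_mx 0 l : 'rV[k]_3) = w l.
      rewrite fE (bigD1 l) //= mxE !eqxx !scale1r big1 ?addr0 // => m /negPf ml.
      by rewrite mxE ml andbF scale0r scale0r.
    by rewrite raddfB /= !fdelta.
  (* If all w_j were equal, 3 w_3 would be their sum, which is 0. *)
  have [j wj] : exists j, w j != w pt3.
    apply/existsP; apply: contraNT w0 => /existsPn w_eq.
    have {}w_eq j : w j = w pt3 by have := w_eq j; rewrite negbK => /eqP.
    apply/eqP/(A0_scalar_eq0 three0).
    rewrite scaler_nat scaler_nat -[RHS]sw -/w -{1}(card_ord 3) -sumr_const.
    by apply: eq_bigr => j _; rewrite w_eq.
  apply: (iso (S_st k) (f \o g : {linear S_st k -> M})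
              (in_submod (sum0_space k) (d j))).
    exact: S_st_simple.
  by rewrite /= gE in_submodK ?delta_sub_sum0 // fd subr_eq0 eq_sym.
apply: Or32.
have H12 (v : M) : H_ k (tperm pt1 pt2) *: v = - v.
  apply/eqP; rewrite -addr_eq0 addrC -perm_image3.
  by apply: contra_notT noinv => w0; exists v.
have [[v v0] _] := simM.
have [|//|g gE] := @ext_hom k 1 (W_sgn k) M (fun=> v).
  by move=> t j; rewrite big_ord1 !ord1 mxE eqxx A0_sign_scale; apply: sign_act.
apply: (iso (S_sgn k) g (const_mx 1 : 'rV[k]_1)).
  exact: ext_dim1_simple.
by rewrite gE big_ord1 mxE !scale1r.
Qed.

Theorem proposition5p2 (k : closedFieldType) (k_char0 : [pchar k]%R =i pred0) :
  [/\ simple_module (S_eps k), simple_module (S_sgn k) & simple_module (S_st k)]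
  /\ [/\ ~ isomorphic_modules (S_eps k) (S_sgn k),
         ~ isomorphic_modules (S_eps k) (S_st k)
       & ~ isomorphic_modules (S_sgn k) (S_st k)]
  /\ forall M : lmodType (A0 k), simple_module M ->
       [\/ isomorphic_modules M (S_eps k),
           isomorphic_modules M (S_sgn k)
         | isomorphic_modules M (S_st k)].
Proof.
(* Characteristic zero enters through 2 and 3: 2 keeps the signs 1 and -1 distinct, 3 excludes
   nonzero constant families of sum 0. *)
have nat0 n : n.+1%:R != 0 :> k by have /pcharf0P-> := k_char0.
split; [|split=> [|M]].
- split; [exact: ext_dim1_simple|exact: ext_dim1_simple|].
  exact/S_st_simple/nat0.
- split; [exact/S_eps_S_sgn/nat0|exact: S_eps_S_st|exact: S_sgn_S_st].
exact: simple_A0_module (nat0 _).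
Qed.
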